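(* Let $K$ be an interface element. Then there exists a point $\widehat M_K$ such that $$\widehat M_K\in\widehat K,\qquad (\widehat\nabla\widehat\Pi\widehat w)(\widehat M_K)=\lambda\,\widehat n_h\quad\text{for some }\lambda\in[0,1].$$
   Context: Let $N\in\{2,3\}$, let $\Omega\subset\mathbb R^N$ be a bounded convex polygonal/polyhedral domain and $\Gamma\subset\Omega$ a closed $C^2$ hypersurface separating $\Omega$ into two subdomains; $\Omega^-$ is one of them and $\Omega^+$ is the other one together with $\Gamma$. $n$ is the unit normal to $\Gamma$ pointing toward $\Omega^+$. For a region $T$, $T^\pm=T\cap\Omega^\pm$. $\{\mathcal K_h\}_{h>0}$ is a family of conforming quadrilateral ($N=2$) / hexahedral ($N=3$) meshes of $\Omega$ generated independently of $\Gamma$; $h_K=\operatorname{diam}K$. The reference element is $\widehat K=[-1,1]^N$ with vertex set $\widehat{\mathcal N}$; $Q_1(\widehat K)=\operatorname{span}\{\widehat x_1^{\alpha_1}\cdots\widehat x_N^{\alpha_N}:\alpha_i\in\{0,1\}\}$. Each $K\in\mathcal K_h$ is $F_K(\widehat K)$ with $F_K\in Q_1(\widehat K)^N$ bijective onto $K$, $J_K=DF_K$, $\det J_K>0$ on $\widehat K$. $K$ is an interface element if $\Gamma\cap\operatorname{int}(K)\ne\emptyset$; then $\Gamma_K=\Gamma\cap K$, $\widehat\Gamma_K=F_K^{-1}(\Gamma_K)$, $\widehat K^\pm=F_K^{-1}(K^\pm)$. On an interface element $K$ one selects a point $x_K\in K$ and a constant unit vector $n_h$ and sets $\widehat x_K=F_K^{-1}(x_K)$,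 $\widehat n_h=J_K(\widehat x_K)^\top n_h/|J_K(\widehat x_K)^\top n_h|$, $\widehat\ell_K(\widehat x)=(\widehat x-\widehat x_K)\cdot\widehat n_h$. Standing assumption: $|x_K-x_{\Gamma_K}|+h_K|n_h-n(x_{\Gamma_K})|\le Ch_K^2$ for some $x_{\Gamma_K}\in\Gamma_K$; $\widehat\Gamma_K$ meets each edge of $\widehat K$ at most once; and, with $\mathcal I_K^+=\widehat{\mathcal N}\cap\widehat K^+$, $\mathcal I_K^-=\widehat{\mathcal N}\setminus\mathcal I_K^+$, $\mathcal I_{h,K}^+=\{\widehat A\in\widehat{\mathcal N}:\widehat\ell_K(\widehat A)\ge0\}$, $\mathcal I_{h,K}^-=\widehat{\mathcal N}\setminus\mathcal I_{h,K}^+$, one has $\mathcal I_K^s=\mathcal I_{h,K}^s\neq\emptyset$ for $s\in\{+,-\}$. $\widehat\Pi$ is the nodal $Q_1(\widehat K)$ interpolation operator at the vertices of $\widehat K$. The function $\widehat w$ is defined by $\widehat w=\widehat\ell_K$ on $\widehat K^+$ and $\widehat w=0$ on $\widehat K^-$. $\widehat\nabla$ is the gradient with respect to $\widehat x$. *)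

(* Defs.v *)
From HB Require Import structures.
From mathcomp Require Import all_boot all_order all_algebra.
From mathcomp Require Import all_classical all_reals all_analysis.

Set Implicit Arguments.
Unset Strict Implicit.
Unset Printing Implicit Defensive.

Import Order.TTheory GRing.Theory Num.Theory.
Import numFieldNormedType.Exports.

Local Open Scope classical_set_scope.
Local Open Scope ring_scope.

(* Points of R^N are row vectors, as for the library's [jacobian].  Their
   library norm is the sup norm (same topology), so the Euclidean norm is
   introduced separately. *)

Section Calculus.
Variables (R : realType) (N : nat).
Implicit Types (u v x : 'rV[R]_N) (f : 'rV[R]_N -> R) (A : set 'rV[R]_N).

Definition dot u v : R := \sum_i u 0 i * v 0 i.

Definition enorm u : R := Num.sqrt (dot u u).

Definition diam A : R := sup [set enorm (x - y) | x in A & y in A].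

Definition partial f (i : 'I_N) : 'rV[R]_N -> R :=
  fun x => 'D_(delta_mx 0 i) f x.

Definition grad f x : 'rV[R]_N := \row_i partial f i x.

(* [jacobian F x] acts on row vectors from the right; its transpose is the
   usual matrix with entries d F_i / d x_j. *)
Definition Jac (F : 'rV[R]_N -> 'rV[R]_N) x : 'M[R]_N := (jacobian F x)^T.

Definition C1_on A f := forall i x, A x ->
  derivable f x (delta_mx 0 i) /\ {for x, continuous (partial f i)}.

Definition C2_on A f := C1_on A f /\ forall i, C1_on A (partial f i).

End Calculus.

Section Geometry.
Variables (R : realType) (N : nat).
Local Notation V := 'rV[R]_N.

(* Bounded convex polygonal/polyhedral domain: a nonempty bounded intersection
   of finitely many open half-spaces. *)
Definition convex_polytope_domain (Om : set V) :=
  [/\ exists (m : nat) (a : 'I_m -> V) (b : 'I_m -> R),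
        Om = [set x | forall i, dot (a i) x < b i],
      bounded_set Om & Om !=set0].

Definition local_equation (Gam : set V) (p : V) (U : set V) (phi : V -> R) :=
  [/\ open U, U p, C2_on U phi,
      forall x, U x -> (Gam x <-> phi x = 0) &
      forall x, U x -> grad phi x != 0].

(* "Closed" hypersurface: compact and without boundary. *)
Definition closed_C2_hypersurface (Gam : set V) :=
  compact Gam /\ forall p, Gam p -> exists U phi, local_equation Gam p U phi.

Definition subdomain (D : set V) := [/\ open D, connected D & D !=set0].

(* Omm and Omp `\` Gam are the two subdomains; Omp contains Gam. *)
Definition separates (Om Gam Omm Omp : set V) :=
  [/\ Gam `<=` Omp, subdomain Omm, subdomain (Omp `\` Gam),
      Omm `&` Omp = set0 & Omm `|` Omp = Om].

Definition unit_normal_toward (Gam Omp : set V) (n : V -> V) :=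
  forall p, Gam p ->
  [/\ enorm (n p) = 1,
      forall U phi, local_equation Gam p U phi ->
        exists c : R, grad phi p = c *: n p &
      \forall t \near 0^'+, Omp (p + t *: n p)].

End Geometry.

Section ReferenceElement.
Variables (R : realType) (N : nat).
Local Notation V := 'rV[R]_N.

Definition Khat : set V := [set x | forall i, -1 <= x 0 i <= 1].

Definition vertex (s : {ffun 'I_N -> bool}) : V :=
  \row_i (if s i then 1 else -1).

Definition vertices : set V := range vertex.

(* Closed face of Khat on which the coordinate x_i is fixed to 1 (-1) when
   [s i] is [Some true] ([Some false]) and free when [s i] is [None]. *)
Definition face (s : 'I_N -> option bool) : set V :=
  [set x | Khat x /\ forall i,
     if s i is Some b then x 0 i = if b then 1 else -1 else True].

Definition proper_face (s : 'I_N -> option bool) := exists i, s i <> None.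

Definition edge_face (s : 'I_N -> option bool) :=
  exists j, forall i, s i = None <-> i = j.

Definition in_Q1 (p : V -> R) := exists c : {ffun 'I_N -> 'I_2} -> R,
  forall x, p x = \sum_a c a * \prod_i x 0 i ^+ a i.

(* Nodal Q1 interpolation, written in the nodal basis of Q1(Khat); see
   [Q1interp_in_Q1], [Q1interp_vertex] and [Q1interp_id]. *)
Definition Q1interp (f : V -> R) : V -> R := fun x =>
  \sum_(s : {ffun 'I_N -> bool})
    f (vertex s) * \prod_i ((1 + vertex s 0 i * x 0 i) / 2).

Lemma Q1interp_in_Q1 f : in_Q1 (Q1interp f).
Proof.
exists (fun a : {ffun 'I_N -> 'I_2} =>
  \sum_(s : {ffun 'I_N -> bool})
     f (vertex s) * \prod_i (vertex s 0 i ^+ a i / 2)) => x.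
under [RHS]eq_bigr do rewrite mulr_suml.
rewrite exchange_big /=; apply: eq_bigr => s _.
under [RHS]eq_bigr do rewrite -mulrA -big_split /=.
rewrite -mulr_sumr; congr (_ * _).
rewrite -(bigA_distr_bigA (fun i (k : 'I_2) =>
  vertex s 0 i ^+ k / 2 * x 0 i ^+ k)).
apply: eq_bigr => i _; rewrite big_ord_recl big_ord1 /= !expr0 !expr1.
by rewrite mulr1 mul1r mulrDl mul1r mulrAC.
Qed.

Lemma Q1interp_vertex f s : Q1interp f (vertex s) = f (vertex s).
Proof.
have two0 : 2 != 0 :> R by rewrite pnatr_eq0.
rewrite /Q1interp (bigD1 s) //= [X in _ + X]big1 ?addr0 => [|t ts].
  rewrite big1 ?mulr1 // => i _; rewrite mxE.
  by case: (s i); rewrite ?mulrNN mulr1 divff.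
have /eqP/ffunP ns := ts.
have [i si] : exists i, t i != s i.
  apply/existsP; rewrite -negb_forall; apply/negP => /forallP E.
  by apply: ns => i; apply/eqP.
rewrite (bigD1 i) //= !mxE; case: (t i) (s i) si => [] [] //= _;
  by rewrite ?mulr1 ?mul1r subrr mul0r mul0r mulr0.
Qed.

Lemma Q1interp_id p : in_Q1 p -> Q1interp p = p.
Proof.
have two0 : 2 != 0 :> R by rewrite pnatr_eq0.
case=> c pE; apply/funext => x; rewrite /Q1interp.
under eq_bigr do rewrite pE mulr_suml.
rewrite exchange_big /= pE; apply: eq_bigr => a _.
under eq_bigr do rewrite -mulrA -big_split /=.
rewrite -mulr_sumr; congr (_ * _).
transitivity (\sum_(s : {ffun 'I_N -> bool}) \prod_i
  ((if s i then 1 else -1) ^+ a i * ((1 + (if s i then 1 else -1) * x 0 i) / 2))).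
  by apply: eq_bigr => s _; apply: eq_bigr => i _; rewrite mxE.
rewrite -(bigA_distr_bigA (fun i (b : bool) =>
  (if b then 1 else -1) ^+ a i * ((1 + (if b then 1 else -1) * x 0 i) / 2))).
apply: eq_bigr => i _; rewrite big_bool /= expr1n !mul1r mulN1r.
case: (a i) => [] [|[|//]] /= _; rewrite ?expr0 ?expr1 ?mul1r ?mulN1r -?mulNr -mulrDl.
  by rewrite addrACA subrr addr0 divff.
by rewrite opprB addrC addrA subrK -mulr2n -(mulr_natr (x 0 i)) mulfK.
Qed.

End ReferenceElement.

Arguments Khat R N : clear implicits.
Arguments vertices R N : clear implicits.
Arguments face R {N} s.

Section Mesh.
Variables (R : realType) (N : nat).
Local Notation V := 'rV[R]_N.

(* Element maps are defined on all of R^N, being polynomial. *)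
Record mesh := Mesh { elements : set (set V); elt_map : set V -> V -> V }.

Definition Q1_element (K : set V) (F : V -> V) :=
  [/\ forall i, in_Q1 (fun x => F x 0 i),
      set_bij (Khat R N) K F &
      forall x, Khat R N x -> 0 < \det (Jac F x)].

Definition conforming_mesh (Om : set V) (T : mesh) :=
  [/\ finite_set (elements T),
      closure Om = \bigcup_(K in elements T) K,
      forall K, elements T K -> Q1_element K (elt_map T K) &
      forall K K', elements T K -> elements T K' -> K <> K' ->
        K `&` K' = set0 \/
        exists s s', [/\ proper_face s, proper_face s',
          K `&` K' = elt_map T K @` face R s &
          K `&` K' = elt_map T K' @` face R s']].

Definition interface_element (Gam K : set V) := Gam `&` K° !=set0.

End Mesh.

Section InterfaceElement.
Variables (R : realType) (N : nat).
Local Notation V := 'rV[R]_N.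
Variables (Gam Omp : set V) (n : V -> V).
Variables (K : set V) (F : V -> V) (xK nh : V).

(* Inverse image under F : Khat -> K. *)
Definition pullback (A : set V) : set V := Khat R N `&` F @^-1` (K `&` A).

Definition xhat : V := 'pinv_(fun=> 0) (Khat R N) F xK.

(* For row vectors, J^T nh reads nh *m J. *)
Definition nhat : V :=
  let v := nh *m Jac F xhat in (enorm v)^-1 *: v.

Definition ellhat (x : V) : R := dot (x - xhat) nhat.

Definition Iplus : set V := vertices R N `&` pullback Omp.
Definition Iminus : set V := vertices R N `\` Iplus.
Definition Ihplus : set V := vertices R N `&` [set A | 0 <= ellhat A].
Definition Ihminus : set V := vertices R N `\` Ihplus.

(* Zero on the pullback of Omm, and also at the remaining points of Khat, which
   F sends to the boundary of Om; accordingly their vertices lie in Iminus. *)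
Definition what : V -> R := patch (fun=> 0) (pullback Omp) ellhat.

Definition interface_selection (C : R) :=
  [/\ K xK,
      enorm nh = 1,
      exists2 xG, (Gam `&` K) xG &
        enorm (xK - xG) + diam K * enorm (nh - n xG) <= C * diam K ^+ 2,
      forall s, edge_face s -> is_subset1 (pullback Gam `&` face R s) &
      [/\ Iplus = Ihplus, Iplus !=set0, Iminus = Ihminus & Iminus !=set0]].

End InterfaceElement.

(* Main.v *)
Require Import Defs.
From HB Require Import structures.
From mathcomp Require Import all_boot all_order all_algebra.
From mathcomp Require Import all_classical all_reals all_analysis.
From mathcomp Require Import ring lra.

Import Order.TTheory GRing.Theory Num.Theory.
Import numFieldNormedType.Exports.

Local Open Scope classical_set_scope.
Local Open Scope ring_scope.

(* At the vertices the interpolated function equals max(l, 0), where l is affine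
   with gradient a = nhat. Its Q1 interpolant at x is the expectation of
   max(l(X), 0) for independent signs X_i of mean x_i, so its i-th partial
   derivative is a_i times an averaged slope of max(., 0), in [0, 1] and
   independent of x_i. It remains to make the averaged slopes equal. After
   reflections, a_i >= 0; by convexity, where x_i = 1 and x_j = -1 the i-th
   averaged slope is at most the j-th. For N = 3 the common value is then found
   on the faces x_i = 1 by applying the intermediate value theorem along an edge
   and along segments; N = 2 is the case where a third component of a
   vanishes. *)

(** * Slopes of the positive part and their averages *)

Section Slopes.
Variable R : realType.
Implicit Types a b c t u v w y z : R.

(* Slope of [max(., 0)] between [z - a] and [z + a]; at [a = 0] a subgradient is
   chosen, so that [le_slope] needs no case distinction. *)
Definition slope a z : R :=
  if a == 0 then (0 <= z)%R%:R
  else (Num.max (z + a) 0 - Num.max (z - a) 0) / (2 * a).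

Lemma slopeE a z :
  a * slope a z = (Num.max (z + a) 0 - Num.max (z - a) 0) / 2.
Proof.
rewrite /slope; case: eqVneq => [->|a0]; last by field.
by rewrite addr0 subr0 subrr !mul0r.
Qed.

Lemma slopeN a z : slope (- a) z = slope a z.
Proof.
rewrite /slope oppr_eq0; case: eqVneq => // a0.
by rewrite opprK; field.
Qed.

Lemma slope_norm a z : slope `|a| z = slope a z.
Proof. by case: (ger0P a); rewrite ?slopeN. Qed.

Lemma slope_ge0_le1 a z : 0 <= slope a z <= 1.
Proof.
rewrite -slope_norm /slope; case: eqVneq => [_|a0].
  by case: (0 <= z); rewrite ?lexx ?ler01.
have a_gt0 : 0 < `|a| by rewrite lt_def a0 normr_ge0.
rewrite ler_pdivlMr ?ler_pdivrMr ?mulr_gt0 // mul0r mul1r.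
by case: (lerP (z + `|a|) 0); case: (lerP (z - `|a|) 0); lra.
Qed.

(** Slopes of a convex function increase: if y + a < 0, the left interval has slope 0; otherwise z -
    b >= 0 and the right one has slope 1. *)
Lemma le_slope a b y z : 0 <= a -> 0 <= b -> y + a <= z - b ->
  slope a y <= slope b z.
Proof.
move=> a_ge0 b_ge0 yz.
have /andP[ya_ge0 ya_le1] := slope_ge0_le1 a y.
have /andP[zb_ge0 zb_le1] := slope_ge0_le1 b z.
have [ya0|ya0] := ltP (y + a) 0.
  suff -> : slope a y = 0 by [].
  rewrite /slope; case: eqVneq => [a0|_].
    by rewrite leNgt (_ : y < 0) //; lra.
  by rewrite !max_r ?subrr ?mul0r //; lra.
suff -> : slope b z = 1 by [].
rewrite /slope; case: eqVneq => [b0|b0]; first by rewrite (_ : 0 <= z) //; lra.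
by rewrite !max_l ?(le_trans ya0) //; [field|lra].
Qed.

(* Expectation of [f] under the law on [{1, -1}] of mean [t]. *)
Definition mean t (f : R -> R) : R := (1 + t) / 2 * f 1 + (1 - t) / 2 * f (- 1).

(* With X, Y, Z independent signs of means x, y, z, the derivative of
   [E max(a X + b Y + c Z - k, 0)] in x is [a * mean_slope k a b y c z]. *)
Definition mean_slope k a b y c z : R :=
  mean y (fun s => mean z (fun t => slope a (b * s + c * t - k))).

Lemma mean_slopeC k a b y c z : mean_slope k a b y c z = mean_slope k a c z b y.
Proof.
rewrite /mean_slope /mean (addrC (c * 1)) (addrC (c * -1) (b * 1)).
by rewrite (addrC (c * 1)) (addrC (c * -1)); ring.
Qed.

Lemma mean_slope_norml k a b y c z :
  mean_slope k `|a| b y c z = mean_slope k a b y c z.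
Proof. by rewrite /mean_slope /mean !slope_norm. Qed.

Lemma mean_slopeN k a b y c z :
  mean_slope k a (- b) y c z = mean_slope k a b (- y) c z.
Proof.
by rewrite /mean_slope /mean !mulrNN !mulNr !mulrN opprK !mulr1; ring.
Qed.

Definition sign b : R := if 0 <= b then 1 else -1.

Lemma mean_slope_normm k a b y c z :
  mean_slope k a `|b| y c z = mean_slope k a b (sign b * y) c z.
Proof.
by rewrite /sign; case: (ger0P b); rewrite ?mean_slopeN (mul1r, mulN1r).
Qed.

Lemma mean_bounds t f u v : -1 <= t <= 1 ->
  u <= f 1 <= v -> u <= f (- 1) <= v -> u <= mean t f <= v.
Proof.
move=> /andP[? ?] /andP[? ?] /andP[? ?].
by rewrite /mean; apply/andP; split; nra.
Qed.

Lemma mean_slope_ge0_le1 k a b y c z : -1 <= y <= 1 -> -1 <= z <= 1 ->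
  0 <= mean_slope k a b y c z <= 1.
Proof. by move=> y1 z1; do !apply: mean_bounds => //; apply: slope_ge0_le1. Qed.

(** With Y = -1 on the left and X = 1 on the right, for each value of Z the interval of the a-slope
    ends where that of the b-slope begins. *)
Lemma le_mean_slope k a b c z : 0 <= a -> 0 <= b -> -1 <= z <= 1 ->
  mean_slope k a b (- 1) c z <= mean_slope k b a 1 c z.
Proof.
move=> a0 b0 /andP[z_ge z_le].
have h t : slope a (b * -1 + c * t - k) <= slope b (a * 1 + c * t - k).
  by apply: le_slope => //; lra.
rewrite /mean_slope /mean subrr opprK !mul0r add0r addr0.
have -> : ((1 + 1) / 2 : R) = 1 by field.
rewrite !mul1r; apply: lerD; apply: ler_wpM2l => //; lra.
Qed.

(** * Continuity in the means and intermediate values *)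

Lemma continuous_zero (f : R -> R) a b : a <= b -> continuous f ->
  f a <= 0 -> 0 <= f b -> exists2 t, a <= t <= b & f t = 0.
Proof.
move=> ab fc fa fb.
have [||t] := @IVT R f a b 0 ab.
- exact: continuous_subspaceT.
- by rewrite ge_min fa le_max fb orbT.
by rewrite in_itv; exists t.
Qed.

Lemma continuous_mean (f : R -> R) (g : R -> R -> R) : continuous f ->
  continuous (g^~ 1) -> continuous (g^~ (- 1)) ->
  continuous (fun t => mean (f t) (g t)).
Proof.
move=> fc g1 gN1 t; rewrite /mean.
by apply: cvgD; apply: cvgM; [apply: cvgM| |apply: cvgM|];
  [apply: cvgD; [exact: cvg_cst|exact: fc]|exact: cvg_cst|exact: g1
  |apply: cvgB; [exact: cvg_cst|exact: fc]|exact: cvg_cst|exact: gN1].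
Qed.

Lemma continuous_mean_slope k a b (f : R -> R) c (g : R -> R) :
  continuous f -> continuous g ->
  continuous (fun t => mean_slope k a b (f t) c (g t)).
Proof.
move=> fc gc; apply: continuous_mean => //;
  apply: continuous_mean => // t; exact: cvg_cst.
Qed.

Lemma continuous_segment u v : continuous (fun t => u + t * (v - u)).
Proof.
by move=> t; apply: cvgD; [|apply: cvgM]; (exact: cvg_cst || exact: cvg_id).
Qed.

(** * A point where the three averaged slopes agree *)

(* On the face [x = 1] the b- and c-slopes are affine and agree along a segment
   from some [(1, y0, z0)] with [y0 = -1] or [z0 = -1] to [(1, 1, t)]. At the
   start the a-slope is at most their common value, by [le_mean_slope]; at the
   end it is at least that value. *)
Lemma mean_slope_equal_from_edge k a b c t :
  0 <= a -> 0 <= b -> 0 <= c -> -1 <= t <= 1 ->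
  mean_slope k b a 1 c t = mean_slope k c a 1 b 1 ->
  mean_slope k b a 1 c t <= mean_slope k a b 1 c t ->
  exists x y z, [/\ -1 <= x <= 1, -1 <= y <= 1, -1 <= z <= 1,
    mean_slope k a b y c z = mean_slope k b a x c z &
    mean_slope k a b y c z = mean_slope k c a x b y].
Proof.
move=> a0 b0 c0 t1 l23 l21.
have I1 : -1 <= (1 : R) <= 1 by lra.
have IN1 : -1 <= (-1 : R) <= 1 by lra.
have N11 : (-1 : R) <= 1 by lra.
have cst_cont u : continuous (fun _ : R => u) by move=> ?; exact: cvg_cst.
have id_cont : continuous (fun u : R => u) by move=> ?; exact: cvg_id.
have [y0 [z0 [y01 z01 D0 l0]]] : exists y0 z0, [/\ -1 <= y0 <= 1,
    -1 <= z0 <= 1, mean_slope k b a 1 c z0 = mean_slope k c a 1 b y0 &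
    mean_slope k a b y0 c z0 <= mean_slope k b a 1 c z0].
  (* The corner (1, -1, -1) decides along which edge to move: raise y on z = -1 if the c-slope is at
     most the b-slope there, else raise z on y = -1. By [le_mean_slope] the order is reversed at the
     far end. *)
  have [D|D] := lerP (mean_slope k c a 1 b (-1)) (mean_slope k b a 1 c (-1)).
    have [||||y0 y01 /eqP] := @continuous_zero
        (fun y => mean_slope k c a 1 b y - mean_slope k b a 1 c (-1)) (-1) 1
      => //.
    - move=> y; apply: cvgB; last exact: cvg_cst.
      exact: (@continuous_mean_slope k c a (fun=> 1) b id).
    - by rewrite subr_le0.
    - rewrite subr_ge0 (mean_slopeC k b) (mean_slopeC k c).
      exact: le_mean_slope.
    rewrite subr_eq0 => /eqP e; exists y0, (-1); split => //.
    by rewrite -e mean_slopeC; apply: le_mean_slope.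
  have [||||z0 z01 /eqP] := @continuous_zero
      (fun z => mean_slope k b a 1 c z - mean_slope k c a 1 b (-1)) (-1) 1
    => //.
  - move=> z; apply: cvgB; last exact: cvg_cst.
    exact: (@continuous_mean_slope k b a (fun=> 1) c id).
  - by rewrite subr_le0 ltW.
  - rewrite subr_ge0 (mean_slopeC k b) (mean_slopeC k c).
    exact: le_mean_slope.
  rewrite subr_eq0 => /eqP e; exists (-1), z0; split => //.
  exact: le_mean_slope.
pose Y s := y0 + s * (1 - y0); pose Z s := z0 + s * (t - z0).
have Dseg s : mean_slope k b a 1 c (Z s) = mean_slope k c a 1 b (Y s).
  apply/eqP; rewrite -subr_eq0.
  suff -> : mean_slope k b a 1 c (Z s) - mean_slope k c a 1 b (Y s) =
      (1 - s) * (mean_slope k b a 1 c z0 - mean_slope k c a 1 b y0) +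
      s * (mean_slope k b a 1 c t - mean_slope k c a 1 b 1).
    by rewrite D0 l23 !subrr !mulr0 addr0.
  by rewrite /mean_slope /mean /Y /Z; field.
have [||||s s01 /eqP] := @continuous_zero
    (fun s => mean_slope k a b (Y s) c (Z s) - mean_slope k b a 1 c (Z s)) 0 1
  => //.
- move=> s; apply: cvgB.
    by apply: continuous_mean_slope; apply: continuous_segment.
  by apply: (@continuous_mean_slope k b a (fun=> 1)) => //;
    apply: continuous_segment.
- by rewrite /Y /Z !mul0r !addr0 subr_le0.
- by rewrite /Y /Z !mul1r !subrKC subr_ge0.
rewrite subr_eq0 => /eqP e; exists 1, (Y s), (Z s).
move: s01 y01 z01 t1 => /andP[? ?] /andP[? ?] /andP[? ?] /andP[? ?].
by split; rewrite ?I1 // ?e // /Y /Z; apply/andP; split; nra.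
Qed.

(* Along the edge [(1, 1, t)] the c-slope is constant, and the minimum of the
   other two goes from below it to above it. *)
Lemma mean_slope_equal_of_min k a b c : 0 <= a -> 0 <= b -> 0 <= c ->
  mean_slope k c a 1 b 1 <= mean_slope k a b 1 c 1 ->
  mean_slope k c a 1 b 1 <= mean_slope k b a 1 c 1 ->
  exists x y z, [/\ -1 <= x <= 1, -1 <= y <= 1, -1 <= z <= 1,
    mean_slope k a b y c z = mean_slope k b a x c z &
    mean_slope k a b y c z = mean_slope k c a x b y].
Proof.
move=> a0 b0 c0 l31 l32.
have I1 : -1 <= (1 : R) <= 1 by lra.
have N11 : (-1 : R) <= 1 by lra.
have cst_cont u : continuous (fun _ : R => u) by move=> ?; exact: cvg_cst.
have id_cont : continuous (fun u : R => u) by move=> ?; exact: cvg_id.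
have [||||t t1 /eqP] := @continuous_zero (fun t =>
    Num.min (mean_slope k a b 1 c t) (mean_slope k b a 1 c t) -
    mean_slope k c a 1 b 1) (-1) 1 => //.
- move=> t; apply: cvgB; last exact: cvg_cst.
  apply: continuous_min.
    exact: (@continuous_mean_slope k a b (fun=> 1) c id).
  exact: (@continuous_mean_slope k b a (fun=> 1) c id).
- by rewrite subr_le0 ge_min (mean_slopeC k a) le_mean_slope.
- by rewrite subr_ge0 le_min l31.
rewrite subr_eq0.
(* Whichever slope attains the minimum takes the role of the b-slope in
   [mean_slope_equal_from_edge]. *)
have [l12|l21] := leP (mean_slope k a b 1 c t) (mean_slope k b a 1 c t).
  move=> /eqP e.
  have [|x [y [z [x1 y1 z1 exy exz]]]] :=
      @mean_slope_equal_from_edge k b a c t b0 a0 c0 t1 _ l12.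
    by rewrite e mean_slopeC.
  by exists y, x, z; split => //; rewrite -exy // exz mean_slopeC.
move=> /eqP e.
by apply: (@mean_slope_equal_from_edge _ _ _ _ t) => //; apply: ltW.
Qed.

(** Relabel the coordinates so that the smallest slope at the corner (1, 1, 1) is the c-slope. *)
Lemma mean_slope_equal_nonneg k a b c : 0 <= a -> 0 <= b -> 0 <= c ->
  exists x y z, [/\ -1 <= x <= 1, -1 <= y <= 1, -1 <= z <= 1,
    mean_slope k a b y c z = mean_slope k b a x c z &
    mean_slope k a b y c z = mean_slope k c a x b y].
Proof.
move=> a0 b0 c0.
have [l31|l13] := leP (mean_slope k c a 1 b 1) (mean_slope k a b 1 c 1).
  have [l32|l23] := leP (mean_slope k c a 1 b 1) (mean_slope k b a 1 c 1).
    exact: mean_slope_equal_of_min.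
  have [||x [z [y [x1 z1 y1 e1 e2]]]] :=
    @mean_slope_equal_of_min k a c b a0 c0 b0.
  - by rewrite (mean_slopeC k a); apply: le_trans l31; apply: ltW.
  - exact: ltW.
  by exists x, y, z; split=> //; rewrite mean_slopeC.
have [l12|l21] := leP (mean_slope k a b 1 c 1) (mean_slope k b a 1 c 1).
  have [||y [z [x [y1 z1 x1 e1 e2]]]] :=
    @mean_slope_equal_of_min k b c a b0 c0 a0.
  - by rewrite (mean_slopeC k b).
  - by rewrite (mean_slopeC k c) ltW.
  by exists x, y, z; rewrite -e2 (mean_slopeC k b a) (mean_slopeC k c a) -e1.
have [||x [z [y [x1 z1 y1 e1 e2]]]] :=
    @mean_slope_equal_of_min k a c b a0 c0 b0.
- by rewrite (mean_slopeC k a) ltW.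
- by apply: ltW; apply: lt_trans l13.
by exists x, y, z; split=> //; rewrite mean_slopeC.
Qed.

(** [slope] is even in its first argument, and the sign of any other coefficient passes to its mean,
    so a solution for |a|, |b|, |c| only has to be reflected. *)
Lemma mean_slope_equal k a b c :
  exists x y z, [/\ -1 <= x <= 1, -1 <= y <= 1, -1 <= z <= 1,
    mean_slope k a b y c z = mean_slope k b a x c z &
    mean_slope k a b y c z = mean_slope k c a x b y].
Proof.
have [x [y [z [x1 y1 z1]]]] :=
  mean_slope_equal_nonneg k _ _ _ (normr_ge0 a) (normr_ge0 b) (normr_ge0 c).
rewrite !mean_slope_norml !mean_slope_normm.
rewrite (mean_slopeC k a) (mean_slopeC k b) (mean_slopeC k c).
rewrite !mean_slope_normm => e1 e2.
have signM u v : -1 <= v <= 1 -> -1 <= sign u * v <= 1.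
  by rewrite /sign; case: ifP => _ /andP[? ?]; apply/andP; split; lra.
exists (sign a * x), (sign b * y), (sign c * z).
rewrite (mean_slopeC k a) (mean_slopeC k b) (mean_slopeC k c).
by split=> //; apply: signM.
Qed.

(** * The expected positive part as a function of the means *)

Lemma eq_mean t (f g : R -> R) :
  f 1 = g 1 -> f (- 1) = g (- 1) -> mean t f = mean t g.
Proof. by rewrite /mean => -> ->. Qed.

Lemma mulr_mean a t (f : R -> R) : a * mean t f = mean t (fun s => a * f s).
Proof. by rewrite /mean; ring. Qed.

(** [E max(a X + b Y + c Z - k, 0)] for independent signs X, Y, Z of means x, y, z. *)
Definition mean_ramp k a x b y c z : R :=
  mean x (fun s => mean y (fun t => mean z (fun u =>
    Num.max (a * s + b * t + c * u - k) 0))).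

(** With [mean_ramp_rot], brings any coordinate to the front, where [mean_ramp_shift] applies. *)
Lemma mean_ramp_swap k a x b y c z :
  mean_ramp k a x b y c z = mean_ramp k b y a x c z.
Proof.
rewrite /mean_ramp /mean.
rewrite (addrC (b * 1)) (addrC (b * -1) (a * 1)) (addrC (b * 1)).
by rewrite (addrC (b * -1)); ring.
Qed.

Lemma mean_ramp_rot k a x b y c z :
  mean_ramp k a x b y c z = mean_ramp k c z a x b y.
Proof.
rewrite (mean_ramp_swap k c) /mean_ramp /mean !(addrAC _ (c * _)).
ring.
Qed.

(** The expectation is affine in x; its coefficient is the averaged half-difference between X = 1
    and X = -1, which [slopeE] turns into a times a slope. *)
Lemma mean_ramp_shift k a x b y c z h :
  mean_ramp k a (h + x) b y c z =
  mean_ramp k a x b y c z + h * (a * mean_slope k a b y c z).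
Proof.
suff -> : a * mean_slope k a b y c z = mean y (fun t => mean z (fun u =>
    (Num.max (a * 1 + b * t + c * u - k) 0 -
     Num.max (a * -1 + b * t + c * u - k) 0) / 2)).
  by rewrite /mean_ramp /mean; field.
by rewrite /mean_slope mulr_mean; apply: eq_mean; rewrite mulr_mean;
  apply: eq_mean; rewrite slopeE; congr ((Num.max _ 0 - Num.max _ 0) / 2); ring.
Qed.

End Slopes.

Arguments mean {R}.
Arguments mean_slope {R}.
Arguments mean_ramp {R}.

(** * The nodal interpolant and its gradient *)

Lemma derive_affine (R : realType) N (f : 'rV[R]_N -> R) (x e : 'rV[R]_N) d :
  (forall h, f (h *: e + x) = f x + h * d) -> 'D_e f x = d.
Proof.
move=> fE; apply: lim_near_cst => //.
near=> h; rewrite /= fE addrC addKr.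
by rewrite /GRing.scale /= mulKf //; near: h; exact: nbhs_dnbhs_neq.
Unshelve. all: by end_near. Qed.

Lemma sum_ffun_bool3 (R : realType) (G : {ffun 'I_3 -> bool} -> R) :
  \sum_s G s = \sum_b0 \sum_b1 \sum_b2
    G [ffun i : 'I_3 => nth false [:: b0; b1; b2] i].
Proof.
pose h (p : bool * (bool * bool)) : {ffun 'I_3 -> bool} :=
  [ffun i : 'I_3 => nth false [:: p.1; p.2.1; p.2.2] i].
rewrite (reindex h) /=; last first.
  exists (fun s => (s 0, (s 1, s (inord 2)))) => [[b0 [b1 b2]]|s] _.
    by rewrite /h !ffunE /= inordK.
  apply/ffunP => -[[|[|[|//]]] i3]; rewrite ffunE /=; congr (s _);
    by apply: val_inj; rewrite //= inordK.
under [RHS]eq_bigr => b0 _ do rewrite (pair_bigA _ (fun b1 b2 =>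
  G [ffun i : 'I_3 => nth false [:: b0; b1; b2] i])).
by rewrite (pair_bigA _ (fun b0 p =>
  G [ffun i : 'I_3 => nth false [:: b0; p.1; p.2] i])).
Qed.

Lemma sum_ffun_bool2 (R : realType) (G : {ffun 'I_2 -> bool} -> R) :
  \sum_s G s = \sum_b0 \sum_b1 G [ffun i : 'I_2 => nth false [:: b0; b1] i].
Proof.
pose h (p : bool * bool) : {ffun 'I_2 -> bool} :=
  [ffun i : 'I_2 => nth false [:: p.1; p.2] i].
rewrite (reindex h) /=; last first.
  exists (fun s => (s 0, s 1)) => [[b0 b1]|s] _; first by rewrite /h !ffunE.
  apply/ffunP => -[[|[|//]] i2]; rewrite ffunE /=; congr (s _);
    by apply: val_inj.
by rewrite (pair_bigA _ (fun b0 b1 =>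
  G [ffun i : 'I_2 => nth false [:: b0; b1] i])).
Qed.

Section Ramp.
Variable R : realType.
Implicit Types k : R.

(** The nodal weight of a vertex s at x is the product of the (1 + s_i x_i) / 2, the probability of
    s under independent signs of means x_i. *)
Lemma Q1interp_ramp3 k (a : 'rV[R]_3) (f : 'rV[R]_3 -> R) x :
  (forall s, f (vertex R s) = Num.max (dot (vertex R s) a - k) 0) ->
  Q1interp f x = mean_ramp k (a 0 0) (x 0 0) (a 0 1) (x 0 1)
                   (a 0 (inord 2)) (x 0 (inord 2)).
Proof.
move=> fE; have i2 : inord 2 = lift ord0 (lift ord0 ord0) :> 'I_3.
  by apply: val_inj; rewrite /= inordK.
have i1 : 1 = lift ord0 ord0 :> 'I_3 by apply: val_inj.
rewrite i1 i2 /Q1interp sum_ffun_bool3 !big_bool /= !fE /dot.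
rewrite !big_ord_recl !big_ord0 !mxE !ffunE /= /mean_ramp /mean.
rewrite !addr0 !mulr1 !mul1r !mulrN1 !mulN1r !addrA.
by field.
Qed.

Lemma Q1interp_ramp2 k (a : 'rV[R]_2) (f : 'rV[R]_2 -> R) x :
  (forall s, f (vertex R s) = Num.max (dot (vertex R s) a - k) 0) ->
  Q1interp f x = mean_ramp k (a 0 0) (x 0 0) (a 0 1) (x 0 1) 0 0.
Proof.
move=> fE; have i1 : 1 = lift ord0 ord0 :> 'I_2 by apply: val_inj.
rewrite i1 /Q1interp sum_ffun_bool2 !big_bool /= !fE /dot.
rewrite !big_ord_recl !big_ord0 !mxE !ffunE /= /mean_ramp /mean.
rewrite !mul0r !addr0 !mulr1 !mul1r !mulrN1 !mulN1r.
by field.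
Qed.

Lemma grad_Q1interp_ramp N k (a : 'rV[R]_N) (f : 'rV[R]_N -> R) :
  N = 2%N \/ N = 3%N ->
  (forall s, f (vertex R s) = Num.max (dot (vertex R s) a - k) 0) ->
  exists2 M, Khat R N M & exists2 l : R, 0 <= l <= 1 &
    grad (Q1interp f) M = l *: a.
Proof.
move=> [] N23; subst N => fE.
  have [x [y [u [x1 y1 u1 exy _]]]] := mean_slope_equal _ k (a 0 0) (a 0 1) 0.
  have I0 : -1 <= (0 : R) <= 1 by lra.
  (* The third coefficient is 0, so the third mean u may be replaced by the 0 of
     [Q1interp_ramp2]. *)
  have mean_slope0 b c t : mean_slope k b c t 0 u = mean_slope k b c t 0 0.
    by rewrite /mean_slope /mean !mul0r; field.
  rewrite !mean_slope0 in exy.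
  exists (\row_i [:: x; y]`_i); first by case=> -[|[|//]] ?; rewrite mxE.
  exists (mean_slope k (a 0 0) (a 0 1) y 0 0); first exact: mean_slope_ge0_le1.
  apply/rowP => i; rewrite !mxE /partial; apply: derive_affine => h.
  rewrite !(Q1interp_ramp2 _ _ _ _ fE) !mxE (mulrC (mean_slope _ _ _ _ _ _)).
  case: i => [[|[|//]] i2] /=.
  - rewrite (_ : Ordinal i2 = 0); last exact: val_inj.
    by rewrite mulr1 mulr0 add0r mean_ramp_shift.
  - rewrite (_ : Ordinal i2 = 1); last exact: val_inj.
    rewrite mulr1 mulr0 add0r !(mean_ramp_swap _ k (a 0 0)) mean_ramp_shift.
    by rewrite exy.
have [x [y [z [x1 y1 z1 exy exz]]]] :=
  mean_slope_equal _ k (a 0 0) (a 0 1) (a 0 (inord 2)).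
exists (\row_i [:: x; y; z]`_i); first by case=> -[|[|[|//]]] ?; rewrite mxE.
exists (mean_slope k (a 0 0) (a 0 1) y (a 0 (inord 2)) z).
  exact: mean_slope_ge0_le1.
apply/rowP => i; rewrite !mxE /partial; apply: derive_affine => h.
rewrite !(Q1interp_ramp3 _ _ _ _ fE) !mxE (mulrC (mean_slope _ _ _ _ _ _)).
case: i => [[|[|[|//]]] i3] /=.
- rewrite (_ : Ordinal i3 = 0); last exact: val_inj.
  rewrite -val_eqE /= inordK //= mulr1 !mulr0 !add0r.
  by rewrite mean_ramp_shift.
- rewrite (_ : Ordinal i3 = 1); last exact: val_inj.
  rewrite -val_eqE /= inordK //= mulr1 !mulr0 !add0r.
  rewrite !(mean_ramp_swap _ k (a 0 0)) mean_ramp_shift.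
  by rewrite exy.
- rewrite (_ : Ordinal i3 = inord 2); last by apply: val_inj; rewrite /= inordK.
  rewrite eqxx /= inordK //= mulr1 !mulr0 !add0r.
  by rewrite !(mean_ramp_rot _ k (a 0 0)) mean_ramp_shift exz.
Qed.

End Ramp.

Theorem lemma2p4 (R : realType) (N : nat)
    (Om Gam Omm Omp : set 'rV[R]_N) (n : 'rV[R]_N -> 'rV[R]_N)
    (Kh : R -> mesh R N) (xK nh : R -> set 'rV[R]_N -> 'rV[R]_N) (C : R) :
  (N = 2%N \/ N = 3%N) ->
  convex_polytope_domain Om ->
  closed_C2_hypersurface Gam ->
  Gam `<=` Om ->
  separates Om Gam Omm Omp ->
  unit_normal_toward Gam Omp n ->
  (forall h, 0 < h -> conforming_mesh Om (Kh h)) ->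
  (forall h K, 0 < h -> elements (Kh h) K -> interface_element Gam K ->
     interface_selection Gam Omp n K (elt_map (Kh h) K) (xK h K) (nh h K) C) ->
  forall h K, 0 < h -> elements (Kh h) K -> interface_element Gam K ->
    exists2 M : 'rV[R]_N, Khat R N M &
      exists2 lam : R, 0 <= lam <= 1 &
        grad (Q1interp
                (what Omp K (elt_map (Kh h) K) (xK h K) (nh h K))) M
        = lam *: nhat (elt_map (Kh h) K) (xK h K) (nh h K).
Proof.
move=> N23 _ _ _ _ _ _ sel h K h0 KK KGam.
have [_ _ _ _ [Ip _ _ _]] := sel h K h0 KK KGam.
set F := elt_map (Kh h) K in Ip *.
(* This k makes [ellhat] at x equal to the inner product of x and [nhat], minus k. *)
apply: (grad_Q1interp_ramp R N
  (dot (xhat F (xK h K)) (nhat F (xK h K) (nh h K)))) => // s.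
have dotB u v w : dot (u - v) w = dot u w - dot v w :> R.
  by rewrite /dot -sumrB; apply: eq_bigr => i _; rewrite !mxE mulrBl.
rewrite -dotB -/(ellhat F (xK h K) (nh h K) _) /what /patch.
have vs : vertices R N (vertex R s) by exists s.
(* Since [Iplus = Ihplus], a vertex lies in the pullback of [Omp] exactly when [ellhat] is
   nonnegative there, so [what] equals max(ellhat, 0) at the vertices. *)
have [l0|l0] := leP 0 (ellhat F (xK h K) (nh h K) (vertex R s)).
  by rewrite mem_set //; have [] : Iplus Omp K F (vertex R s) by rewrite Ip.
case: ifP => // /set_mem pull.
have [_ /=] : Ihplus F (xK h K) (nh h K) (vertex R s) by rewrite -Ip.
by rewrite leNgt l0.
Qed.
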